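(* If $L$ is a Latin square of odd order $n$, then $E_i$ is even whenever $i$ is even.
   Context: A Latin square of order $n$ is an $n\times n$ matrix with symbols from $[n]=\{1,\dots,n\}$ in which each symbol appears exactly once in each row and exactly once in each column. A diagonal of $L$ is a selection of $n$ entries (cells), exactly one from each row and exactly one from each column. $E_i=E_i(L)$ is the number of diagonals of $L$ on which exactly $i$ distinct symbols appear. *)

(* Defs.v *)
From mathcomp Require Import all_boot all_algebra.

Set Implicit Arguments.
Unset Strict Implicit.
Unset Printing Implicit Defensive.

(* Rows, columns and symbols are all indexed by 'I_n = {0, ..., n-1}, in place
   of [n] = {1, ..., n}. *)
Definition latin_square (n : nat) (L : 'M['I_n]_n) : Prop :=
  (forall i s : 'I_n, #|[set j | L i j == s]| = 1) /\
  (forall j s : 'I_n, #|[set i | L i j == s]| = 1).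

(* A cell is a pair (row, column).  That a diagonal has n cells follows from
   its having exactly one in each row. *)
Definition is_diagonal (n : nat) (D : {set 'I_n * 'I_n}) : bool :=
  [forall i : 'I_n, #|[set c in D | c.1 == i]| == 1] &&
  [forall j : 'I_n, #|[set c in D | c.2 == j]| == 1].

Definition diag_symbols (n : nat) (L : 'M['I_n]_n) (D : {set 'I_n * 'I_n}) :
    {set 'I_n} :=
  [set L c.1 c.2 | c in D].

Definition E (n : nat) (L : 'M['I_n]_n) (k : nat) : nat :=
  #|[set D : {set 'I_n * 'I_n} | is_diagonal D & #|diag_symbols L D| == k]|.

(* Main.v *)
Require Import Defs.
From mathcomp Require Import all_boot all_algebra.
From mathcomp Require Import fingroup perm.

Set Implicit Arguments.
Unset Strict Implicit.
Unset Printing Implicit Defensive.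

(** For a set [T] of symbols let [a_T] be the number of diagonals all of whose
    symbols lie in [T].  It is the permanent of the 0-1 matrix marking the cells
    with a symbol in [T], hence it has the parity of the determinant of that
    matrix over the field with two elements.  Every column of the matrix
    contains exactly [#|T|] ones, so when [#|T|] is even the rows sum to zero,
    the determinant vanishes and [a_T] is even ([even_diagonals_within]).

    Inclusion-exclusion modulo 2 expresses [E L i] through these numbers: it is
    congruent to the sum over all [T] of [a_T] times the number of [i]-sets of
    symbols containing [T] ([odd_card_size_eq]).  The second factor is zero if
    [#|T| > i] and is otherwise the binomial coefficient of [n - #|T|] over
    [i - #|T|].  For [n] odd, [i] even and [#|T|] odd its top is even and its
    bottom odd, so it is even ([even_supersets]).  Hence one of the two factors
    is even in every term. *)

Lemma odd_sum (I : finType) (P : pred I) (F : I -> nat) :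
  odd (\sum_(x | P x) F x) = \big[addb/false]_(x | P x) odd (F x).
Proof. exact: (big_morph odd oddD). Qed.

(** * Counting sets between two given sets *)

(** The bijection sends [S] to [S :\: A].  The constraint [Q] on sizes lets the
    same bijection count all sets of an interval as well as those of one size. *)
Lemma card_between (K : finType) (A B : {set K}) (Q : pred nat) :
  A \subset B ->
  #|[set S : {set K} | [&& A \subset S, S \subset B & Q #|S|]]| =
  #|[set R : {set K} | (R \subset B :\: A) && Q (#|A| + #|R|)]|.
Proof.
move=> sAB; rewrite -[RHS](card_in_imset (f := fun R => A :|: R)).
  apply: eq_card => S; rewrite inE; apply/and3P/imsetP.
    case=> sAS sSB QS; exists (S :\: A); last first.
      by rewrite setDE setUIr setUCr setIT; apply/esym/setUidPr.
    by rewrite inE setSD //= cardsD (setIidPr sAS) subnKC // subset_leq_card.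
  case=> R; rewrite inE subsetD -andbA => /and3P[sRB dRA QR] ->.
  split; first exact: subsetUl.
    by rewrite subUset sAB.
  by rewrite cardsU setIC (disjoint_setI0 dRA) cards0 subn0.
move=> R1 R2; rewrite !inE !subsetD -!andbA.
move=> /and3P[_ d1 _] /and3P[_ d2 _] eqU.
have cancelU (R : {set K}) : [disjoint R & A] -> (A :|: R) :\: A = R.
  by move=> dRA; rewrite setDUl setDv set0U; apply/setDidPl.
by rewrite -(cancelU R1) // eqU cancelU.
Qed.

(** If [A \subset S] the interval has [2 ^ #|S :\: A|] members, an odd number only
    when [S :\: A] is empty; otherwise the interval itself is empty. *)
Lemma odd_card_interval (K : finType) (A S : {set K}) :
  odd #|[set T : {set K} | A \subset T & T \subset S]| = (A == S).
Proof.
have [sAS|nsAS] := boolP (A \subset S); last first.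
  rewrite (_ : [set T | _ & _] = set0) ?cards0.
    by apply/esym/negbTE; apply: contraNneq nsAS => ->.
  apply/setP=> T; rewrite !inE; apply/negbTE; apply: contraNN nsAS.
  by case/andP; apply: subset_trans.
have -> : [set T : {set K} | A \subset T & T \subset S] =
          [set T : {set K} | [&& A \subset T, T \subset S & predT #|T|]].
  by apply/setP=> T; rewrite !inE andbT.
rewrite card_between // (_ : [set R | _ & _] = powerset (S :\: A)); last first.
  by apply/setP=> R; rewrite !inE andbT.
rewrite card_powerset oddX orbF cards_eq0 setD_eq0 eqEsubset sAS.
by [].
Qed.

(** The identity [k * 'C(m, k) = m * 'C(m.-1, k.-1)] has an even right-hand side. *)
Lemma odd_bin_even_odd (m k : nat) : ~~ odd m -> odd k -> ~~ odd 'C(m, k).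
Proof.
case: k => // k; case: m => [|m] em ok; first by rewrite bin0n.
have := congr1 odd (mul_bin_diag m.+1 k); rewrite !oddM ok (negbTE em) /=.
by move=> <-.
Qed.

Lemma even_supersets (K : finType) (T : {set K}) (i : nat) :
  odd #|K| -> odd #|T| -> ~~ odd i ->
  ~~ odd #|[set S : {set K} | T \subset S & #|S| == i]|.
Proof.
move=> oK oT ei.
have -> : [set S : {set K} | T \subset S & #|S| == i] =
  [set S : {set K} | [&& T \subset S, S \subset setT & pred1 i #|S|]].
  by apply/setP=> S; rewrite !inE subsetT.
rewrite card_between ?subsetT //=.
have [leTi|ltiT] := leqP #|T| i; last first.
  rewrite (_ : [set R | _ & _] = set0) ?cards0 //.
  apply/setP=> R; rewrite !inE [_ == i]gtn_eqF ?andbF //.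
  by rewrite (leq_trans ltiT) // leq_addr.
rewrite (_ : [set R | _ & _] =
    [set R : {set K} | R \subset setT :\: T & #|R| == i - #|T|]); last first.
  by apply/setP=> R; rewrite !inE -{1}(subnKC leTi) eqn_add2l.
rewrite cards_draws; apply: odd_bin_even_odd.
  by rewrite cardsD setTI cardsT oddB ?max_card // oK oT.
by rewrite oddB // (negbTE ei) oT.
Qed.

(** * Inclusion-exclusion modulo 2 *)

(** Both sides count modulo 2 the triples [(x, T, S)] with
    [f x \subset T \subset S] and [#|S| = i]: for given [x] and [S] the number of
    choices of [T] is odd exactly when [f x = S]. *)
Lemma odd_card_size_eq (X K : finType) (f : X -> {set K}) (i : nat) :
  odd #|[set x | #|f x| == i]| =
  odd (\sum_(T : {set K}) #|[set x | f x \subset T]| *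
                          #|[set S : {set K} | T \subset S & #|S| == i]|).
Proof.
transitivity (odd (\sum_x \sum_(S : {set K} | #|S| == i)
    #|[set T : {set K} | f x \subset T & T \subset S]|)).
  rewrite -sum1dep_card big_mkcond /= !odd_sum; apply: eq_bigr => x _.
  rewrite odd_sum; under eq_bigr => S _ do rewrite odd_card_interval.
  case: ifP => [fxi|fxi].
    rewrite (bigD1 (f x)) //= eqxx big1 // => S /andP[_ neq].
    by rewrite eq_sym (negbTE neq).
  by rewrite big1 // => S Si; apply/eqP => fxS; rewrite fxS Si in fxi.
congr odd.
under eq_bigr => x _.
  under eq_bigr => S _ do rewrite -sum1dep_card big_mkcondr /=.
  rewrite exchange_big /=; over.
rewrite (exchange_big_dep predT) //=; apply: eq_bigr => T _.
rewrite -[#|[set x | _]|]sum1dep_card big_distrl /=; apply: eq_bigr => x _.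
rewrite mul1n -sum1dep_card -big_mkcondr /=; apply: eq_bigl => S.
by rewrite andbC.
Qed.

(** * Diagonals as permutations *)

Definition diagonal_of (n : nat) (s : 'S_n) : {set 'I_n * 'I_n} :=
  [set (r, s r) | r : 'I_n].

Lemma diagonal_of_inj (n : nat) : injective (@diagonal_of n).
Proof.
move=> s t eqst; apply/permP=> r.
have: (r, s r) \in diagonal_of t by rewrite -eqst imset_f.
by case/imsetP=> r' _ [-> ->].
Qed.

Lemma diagonal_ofP (n : nat) (D : {set 'I_n * 'I_n}) :
  reflect (exists s, D = diagonal_of s) (is_diagonal D).
Proof.
apply: (iffP andP) => [[/forallP rowD /forallP colD]|[s ->]].
  have /fin_all_exists[f fP] r : exists j, [set c in D | c.1 == r] = [set (r, j)].
    have /cards1P[[r' j] eqD] := rowD r; exists j; rewrite eqD.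
    have: (r', j) \in [set c in D | c.1 == r] by rewrite eqD set11.
    by rewrite inE => /andP[_ /= /eqP->].
  have fD r : (r, f r) \in D.
    have: (r, f r) \in [set c in D | c.1 == r] by rewrite fP set11.
    by rewrite inE => /andP[].
  have f_inj : injective f.
    move=> r1 r2 eqf; have /cards1P[c eqc] := colD (f r1).
    have c1 : (r1, f r1) \in [set c] by rewrite -eqc inE fD /=.
    have c2 : (r2, f r2) \in [set c] by rewrite -eqc inE fD /= eqf.
    by move: c1 c2; rewrite !inE => /eqP<- /eqP[].
  exists (perm f_inj); apply/setP=> -[r j]; apply/idP/imsetP=> [rjD|[r' _ ->]].
    exists r => //; rewrite permE.
    have: (r, j) \in [set c in D | c.1 == r] by rewrite inE rjD /=.
    by rewrite fP inE => /eqP[->].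
  by rewrite permE.
split; apply/forallP=> x; apply/cards1P.
  exists (x, s x); apply/setP=> -[r j]; rewrite !inE xpair_eqE /=.
  apply/andP/andP => -[].
    by case/imsetP=> r' _ [-> ->] /eqP->.
  by move=> /eqP-> /eqP->; rewrite imset_f.
exists ((s^-1)%g x, x); apply/setP=> -[r j]; rewrite !inE xpair_eqE /=.
apply/andP/andP => -[].
  by case/imsetP=> r' _ [-> ->] /eqP<-; rewrite permK.
by move=> /eqP-> /eqP->; split=> //; apply/imsetP; exists ((s^-1)%g x); rewrite ?permKV.
Qed.

Lemma diag_symbols_of (n : nat) (L : 'M['I_n]_n) (s : 'S_n) :
  diag_symbols L (diagonal_of s) = [set L r (s r) | r : 'I_n].
Proof. by rewrite /diag_symbols -imset_comp. Qed.

Lemma E_perm (n : nat) (L : 'M['I_n]_n) (k : nat) :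
  E L k = #|[set s : 'S_n | #|diag_symbols L (diagonal_of s)| == k]|.
Proof.
rewrite -(card_imset _ (@diagonal_of_inj n)); apply: eq_card => D.
rewrite inE; apply/andP/imsetP => [[/diagonal_ofP[s ->] sk]|[s sk ->]].
  by exists s; rewrite ?inE.
by rewrite inE in sk; split=> //; apply/diagonal_ofP; exists s.
Qed.

(** * Permanent and determinant modulo 2 *)

Import GRing.Theory.
Local Open Scope ring_scope.

Lemma natr_F2_eq0 (m : nat) : (m%:R == 0 :> 'F_2) = ~~ odd m.
Proof. by rewrite -(inj_eq val_inj) /= val_Fp_nat // modn2 eqb0. Qed.

(** Signs are trivial in characteristic 2, so the Leibniz formula for the
    determinant of a 0-1 matrix counts the permutations supported on its
    ones. *)
Lemma det_F2_natr (n : nat) (P : 'I_n -> 'I_n -> bool) :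
  \det (\matrix_(i, j) (P i j)%:R : 'M['F_2]_n) =
  #|[set s : 'S_n | [forall i, P i (s i)]]|%:R.
Proof.
rewrite -sum1dep_card natr_sum big_mkcond /=; apply: eq_bigr => s _.
have -> : -1 = 1 :> 'F_2 by apply/val_inj.
rewrite expr1n mul1r; case: ifP => [/forallP allP|/negbT].
  by rewrite big1 // => i _; rewrite mxE allP.
rewrite negb_forall => /existsP[i /negbTE nPi].
by rewrite (bigD1 i) //= mxE nPi mul0r.
Qed.

(** The all-ones row vector lies in the kernel of the incidence matrix of [T],
    since the sum of each column is [#|T|], which vanishes modulo 2. *)
Lemma even_diagonals_within (n : nat) (L : 'M['I_n]_n) (T : {set 'I_n}) :
  odd n -> latin_square L -> ~~ odd #|T| ->
  ~~ odd #|[set s : 'S_n | diag_symbols L (diagonal_of s) \subset T]|.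
Proof.
move=> on [_ colL] eT.
have -> : [set s : 'S_n | diag_symbols L (diagonal_of s) \subset T] =
          [set s : 'S_n | [forall r, L r (s r) \in T]].
  apply/setP=> s; rewrite !inE diag_symbols_of.
  apply/subsetP/forallP => [sT r|sT _ /imsetP[r _ ->] //].
  by apply: sT; apply/imsetP; exists r.
rewrite -natr_F2_eq0 -(det_F2_natr (fun i j => L i j \in T)).
apply/det0P; exists (const_mx 1).
  case: n on {L colL T eT} => // n _.
  by apply/eqP=> /rowP/(_ 0); rewrite !mxE.
apply/rowP=> j; rewrite !mxE.
under eq_bigr => r _ do rewrite !mxE mul1r.
rewrite -natr_sum -big_mkcond sum1dep_card /=.
suff -> : #|[set r | L r j \in T]| = #|T| by apply/eqP; rewrite natr_F2_eq0.
rewrite -sum1dep_card (partition_big (fun r => L r j) (mem T)) //=.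
rewrite -sum1_card; apply: eq_bigr => x xT; rewrite -[RHS](colL j x) -sum1dep_card.
by apply: eq_bigl => r; apply: andb_idl => /eqP->.
Qed.

Local Close Scope ring_scope.

Theorem theorem37 (n : nat) (L : 'M['I_n]_n) (hn : odd n)
  (hL : latin_square L) (i : nat) (hi : ~~ odd i) : ~~ odd (E L i).
Proof.
rewrite E_perm odd_card_size_eq odd_sum big1 // => T _; apply/negbTE.
rewrite oddM negb_and; have [oT|eT] := boolP (odd #|T|).
  by rewrite even_supersets ?orbT ?card_ord.
by rewrite even_diagonals_within.
Qed.
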